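(* Fix $\gamma_0 > 0$, and let $k,\ell \in \mathbb{N}$ be sufficiently large integers (depending only on $\gamma_0$) with $\gamma_0 \le \gamma \le 1/5$, where $\gamma = \frac{\ell}{k+\ell}$. Then $$R(k,\ell) \le e^{-\delta k + 1} \binom{k + \ell}{\ell},$$ where $\delta = \gamma/40$.
   Context: The Ramsey number $R(k,\ell)$ is the minimum $n \in \mathbb{N}$ such that every red-blue colouring of the edges of the complete graph $K_n$ contains either a red copy of $K_k$ or a blue copy of $K_\ell$. *)

(* Defs.v *)
From mathcomp Require Import all_boot.

Set Implicit Arguments.
Unset Strict Implicit.
Unset Printing Implicit Defensive.

(* A colouring of the edges of K_n is a function on {set 'I_n}; only its values
   on the pairs [set x; y] with x != y, the edges of K_n, are ever used.
   The colour true is red and false is blue. *)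
Definition coloring n := {ffun {set 'I_n} -> bool}.

Definition mono_clique n (c : coloring n) (b : bool) (A : {set 'I_n}) : bool :=
  [forall x in A, forall y in A, (x != y) ==> (c [set x; y] == b)].

Definition has_clique n (c : coloring n) (b : bool) (m : nat) : bool :=
  [exists A : {set 'I_n}, (#|A| == m) && mono_clique c b A].

Definition ramsey_prop (k l n : nat) : bool :=
  [forall c : coloring n, has_clique c true k || has_clique c false l].

Lemma mono_cliqueP n (c : coloring n) b (A : {set 'I_n}) :
  reflect (forall x y, x \in A -> y \in A -> x != y -> c [set x; y] = b)
          (mono_clique c b A).
Proof.
apply: (iffP forall_inP) => [cA x y xA yA xy|cA x xA].
  by have /forall_inP/(_ y yA)/implyP/(_ xy)/eqP := cA x xA.
by apply/forall_inP => y yA; apply/implyP => xy; rewrite cA.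
Qed.

Lemma has_cliqueP n (c : coloring n) b m :
  reflect (exists2 A : {set 'I_n}, #|A| = m & mono_clique c b A)
          (has_clique c b m).
Proof.
apply: (iffP existsP) => [[A /andP[/eqP ? ?]]|[A ? ?]]; exists A => //.
by apply/andP; split => //; apply/eqP.
Qed.

Lemma mono_clique0 n (c : coloring n) b : mono_clique c b set0.
Proof. by apply/mono_cliqueP => x y; rewrite inE. Qed.

Lemma mono_cliqueU1 n (c : coloring n) b v (A : {set 'I_n}) :
    (forall x, x \in A -> c [set v; x] = b) ->
  mono_clique c b A -> mono_clique c b (v |: A).
Proof.
move=> cv /mono_cliqueP cA; apply/mono_cliqueP => x y.
rewrite !inE => /orP[/eqP->|xA] /orP[/eqP->|yA] xy.
- by rewrite eqxx in xy.
- exact: cv.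
- by rewrite setUC cv.
- exact: cA.
Qed.

Lemma ramsey_in n (c : coloring n) m k l (S : {set 'I_n}) :
    k + l <= m -> 2 ^ m <= #|S| ->
  (exists A : {set 'I_n}, [/\ A \subset S, #|A| = k & mono_clique c true A]) \/
  (exists A : {set 'I_n}, [/\ A \subset S, #|A| = l & mono_clique c false A]).
Proof.
elim: m k l S => [|m IHm] [|k] [|l] S //; try by [
  left; exists set0; rewrite sub0set cards0 mono_clique0 |
  right; exists set0; rewrite sub0set cards0 mono_clique0].
rewrite addSn ltnS => klm leS.
have [v vS] : exists v, v \in S.
  by apply/card_gt0P; apply: leq_trans leS; rewrite expn_gt0.
pose N b := [set x in S :\ v | c [set v; x] == b].
have NS b : N b \subset S.
  by apply/subsetP => x; rewrite !inE => /andP[/andP[]].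
have vN b (A : {set 'I_n}) j : A \subset N b -> #|A| = j ->
    mono_clique c b A ->
  [/\ v |: A \subset S, #|v |: A| = j.+1 & mono_clique c b (v |: A)].
  move=> AN Aj cA; split.
  - by rewrite subUset sub1set vS (subset_trans AN).
  - rewrite cardsU1 Aj; case: (boolP (v \in A)) => // vA.
    by have := subsetP AN _ vA; rewrite !inE eqxx.
  - apply: mono_cliqueU1 => // x xA.
    by have := subsetP AN _ xA; rewrite !inE => /andP[_ /eqP].
have cardN : #|N true| + #|N false| = #|S|.-1.
  rewrite (cardsD1 v S) vS add1n /= -(cardsID [set x | c [set v; x]] (S :\ v)).
  by congr (_ + _); apply: eq_card => x; rewrite !inE; case: (c _);
    rewrite ?andbT ?andbF.
have [leT|ltT] := leqP (2 ^ m) #|N true|.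
  have [||[A [AN Ak cA]]|[A [AN Al cA]]] := IHm k l.+1 (N true) => //.
    by left; exists (v |: A); apply: vN.
  by right; exists A; split=> //; apply: subset_trans (NS true).
have leF : 2 ^ m <= #|N false|.
  rewrite -(leq_add2l #|N true|) cardN.
  rewrite -ltnS prednK; last by apply: leq_trans leS; rewrite expn_gt0.
  by apply: leq_trans leS; rewrite expnS mul2n -addnn ltn_add2r.
have [||[A [AN Ak cA]]|[A [AN Al cA]]] := IHm k.+1 l (N false) => //.
- by rewrite addSnnS.
- by left; exists A; split=> //; apply: subset_trans (NS false).
- by right; exists (v |: A); apply: vN.
Qed.

Lemma ramsey_exists k l : exists n, ramsey_prop k l n.
Proof.
exists (2 ^ (k + l)); apply/forallP => c; apply/orP.
have [||[A [_ Ak cA]]|[A [_ Al cA]]] := @ramsey_in _ c (k + l) k l setT => //.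
- by rewrite cardsT card_ord.
- by left; apply/has_cliqueP; exists A.
- by right; apply/has_cliqueP; exists A.
Qed.

Definition ramsey (k l : nat) : nat := ex_minn (ramsey_exists k l).

(* Main.v *)
Require Import Defs.
From mathcomp Require Import all_boot all_order all_algebra.
From mathcomp Require Import all_classical all_reals all_analysis.
From mathcomp Require Import zify ring lra.

Set Implicit Arguments.
Unset Strict Implicit.
Unset Printing Implicit Defensive.

Import Order.TTheory GRing.Theory Num.Theory.
Local Open Scope ring_scope.

(** The idea is to follow one number, the excess of red edges over a fixed
density [q] between two vertex sets [X] and [Y],
  [f (X, Y) = \sum_(x in X) \sum_(y in Y) ((x y is red) - q)],
instead of the sizes and densities separately.

Two facts make it useful.  First, by Cauchy-Schwarz some [v] in [X] satisfies
[f (X, Y') >= q * f (X, Y)], where [Y'] is the red neighbourhood of [v] in [Y]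
([exists_excess_nbhd]).  Secondly [f] is additive in [X], so that, up to the
contribution of [v], the excess [f (X, Y')] is shared between the red and the
blue neighbourhood of [v] in [X].  If [a + b < q], one of them, together with
[Y'], keeps at least [a * f] (a red step: [v] extends a red clique of
[X :|: Y]) or [b * f] (a blue step: [v] extends a blue clique of [X]).  As long
as [Y] is too small to finish by the classical Erdos-Szekeres bound, the lost
contribution of [v] is negligible.  Starting with [X = Y = V], a colouring
without a red [K_k] or a blue [K_l] has
  [(q - a - b) * a^k * (b * (1 - a))^l * f (V, V) < 1]
([excess_lt_of_no_clique]), the factor [(1 - a)^l] coming from Erdos-Szekeres.
When [f (V, V)] is of the order of [n^2], for [n] vertices, this bounds [n^2].

For that the red density must be close to [1 - g], where [g = l / (k + l)].
The blue degrees are at most [R(k, l - 1)], so it suffices that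
[R(k, l - 1) / R(k, l)] is not much above [g], the corresponding ratio for the
binomial coefficients.  In a counterexample the ratio
[rho l = R(k, l) / 'C(k + l, l)] is at least [(39 / 40)^l].  Since [rho <= 1],
going down from [l] while [rho] grows by a factor of more than [21 / 20] must
stop at some [j >= l / 3]; the stopping index [j] has the required density and
still satisfies [rho j >= (39 / 40)^j] ([small_ratio_index],
[exponent_tradeoff]).

For that [j] and [g = j / (k + j)], take [a = 1 - 2 * g], [b = 8 / 10 * g] and
[q = 1 - 11 / 10 * g].  With [n] vertices, the bound above reads
[n^2 * (1 - 2 * g)^k * (8 / 5 * g^2)^j <= poly].  On the other hand [n] is at
least [(39 / 40)^j * ((1 - g)^k * g^j)^-1 / poly], by the lower bound on [rho]
and the size of the binomial coefficient ([binomial_mass]).  The powers of [g]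
cancel, and the factor [(8 / 5)^j] beats the product of the losses [(39 / 40)^(2 * j)]
and [((1 - 2 * g) / (1 - g)^2)^k >= (11 / 15)^j] ([expr_1B2_ge]):
an exponential [(11 / 10)^j] is bounded by a polynomial
([critical_index_bound]), which fails for large [j]. *)

(** * Cliques inside vertex sets *)

Section Cliques.
Variables (n : nat) (c : coloring n).
Implicit Types (b : bool) (A S X Y : {set 'I_n}) (v : 'I_n).

Definition clique_in b m S : bool :=
  [exists A : {set 'I_n}, [&& A \subset S, #|A| == m & mono_clique c b A]].

Definition nbhd b v S : {set 'I_n} :=
  finset (fun x => [&& x \in S, x != v & c [set v; x]%SET == b]).

Lemma in_nbhd b v S x :
  (x \in nbhd b v S) = [&& x \in S, x != v & c [set v; x]%SET == b].
Proof. by rewrite inE. Qed.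

Lemma nbhd_sub b v S : nbhd b v S \subset S.
Proof. by apply/fintype.subsetP => x; rewrite in_nbhd => /and3P[]. Qed.

Lemma has_cliqueE b m : has_clique c b m = clique_in b m [set: 'I_n]%SET.
Proof. by apply: eq_existsb => A; rewrite finset.subsetT. Qed.

Lemma clique_in0 b S : clique_in b 0 S.
Proof.
by apply/existsP; exists finset.set0; rewrite finset.sub0set cards0 eqxx mono_clique0.
Qed.

Lemma clique_inS b m S S' : S \subset S' -> clique_in b m S -> clique_in b m S'.
Proof.
move=> SS' /existsP[A /and3P[AS Am cA]]; apply/existsP; exists A.
by rewrite (fintype.subset_trans AS SS') Am.
Qed.

Lemma clique_inU1 b m v S S' : v \in S' -> S \subset nbhd b v S' ->
  clique_in b m S -> clique_in b m.+1 S'.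
Proof.
move=> vS' SN /existsP[A /and3P[AS /eqP Am cA]].
have AN := fintype.subset_trans AS SN.
apply/existsP; exists (v |: A)%SET; apply/and3P; split.
- by rewrite finset.subUset finset.sub1set vS' (fintype.subset_trans AN (nbhd_sub _ _ _)).
- rewrite cardsU1 Am; case: (boolP (v \in A)) => // vA.
  by have := fintype.subsetP AN _ vA; rewrite in_nbhd eqxx andbF.
- apply: mono_cliqueU1 => // x xA.
  by have := fintype.subsetP AN _ xA; rewrite in_nbhd => /and3P[_ _ /eqP].
Qed.

Lemma card_nbhd v S : v \in S ->
  (#|nbhd true v S| + #|nbhd false v S|).+1 = #|S|.
Proof.
move=> vS; rewrite (cardsD1 v S) vS add1n; congr _.+1.
rewrite -(cardsID (finset (fun x => c [set v; x]%SET)) (S :\ v)%SET).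
by congr (_ + _)%N; apply: eq_card => x; rewrite !inE; case: (c _);
    rewrite ?andbT ?andbF // andbC.
Qed.

(** Pascal's rule is the whole argument: one of the two neighbourhoods of a
vertex is as large as the corresponding summand of the binomial coefficient. *)
Lemma erdos_szekeres k l S : ('C(k + l, l) <= #|S|)%N ->
  clique_in true k S || clique_in false l S.
Proof.
move: k l S; suff H m : forall k l S, (k + l <= m)%N -> ('C(k + l, l) <= #|S|)%N ->
  clique_in true k S || clique_in false l S by move=> k l S; apply: (H (k + l)%N).
elim: m => [|m IHm] [|k] [|l] S; rewrite ?clique_in0 ?orbT // => klm leS.
have [v vS] : exists v, v \in S.
  by apply/card_gt0P; apply: leq_trans leS; rewrite bin_gt0 leq_addl.
have cS := card_nbhd vS.
have klm' : (k.+1 + l <= m)%N by rewrite addSnnS.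
have [leT|ltT] := leqP 'C(k + l.+1, l.+1) #|nbhd true v S|.
  have /orP[cT|cF] := IHm k l.+1 _ klm leT.
    by rewrite (clique_inU1 vS _ cT).
  by rewrite (clique_inS (nbhd_sub _ _ _) cF) orbT.
have leF : ('C(k.+1 + l, l) <= #|nbhd false v S|)%N.
  move: leS ltT; rewrite addSn binS -cS addSnnS.
  move: 'C(_, l) 'C(_, l.+1) #|_| #|_| => x y z w; lia.
have /orP[cT|cF] := IHm k.+1 l _ klm' leF.
  by rewrite (clique_inS (nbhd_sub _ _ _) cT).
by rewrite (clique_inU1 vS _ cF) ?orbT.
Qed.

End Cliques.

Lemma ramseyP k l : ramsey_prop k l (ramsey k l).
Proof. by rewrite /ramsey; case: ex_minnP. Qed.

Lemma ramsey_min k l m : ramsey_prop k l m -> (ramsey k l <= m)%N.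
Proof. by rewrite /ramsey; case: ex_minnP => p _; apply. Qed.

Lemma ramseyn0 k : ramsey k 0 = 0%N.
Proof.
apply/eqP; rewrite -leqn0; apply: ramsey_min; apply/forallP => c.
by rewrite !has_cliqueE clique_in0 orbT.
Qed.

Lemma ramsey_le_bin k l : (ramsey k l <= 'C(k + l, l))%N.
Proof.
apply: ramsey_min; apply/forallP => c; rewrite !has_cliqueE.
by apply: erdos_szekeres; rewrite cardsT card_ord.
Qed.

(** [ramsey] quantifies over colourings of a whole ['I_m]; blue
neighbourhoods are subsets of a larger vertex set, so the colouring is pulled
back along an enumeration of the subset. *)
Lemma ramsey_sub n (c : coloring n) k l (S : {set 'I_n}) :
  (ramsey k l <= #|S|)%N -> clique_in c true k S || clique_in c false l S.
Proof.
move=> leS; pose h (i : 'I_(ramsey k l)) : 'I_n := enum_val (widen_ord leS i).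
have h_inj : injective h by move=> i j /enum_val_inj [] /val_inj.
pose c' : coloring (ramsey k l) := [ffun A : {set _} => c (h @: A)%SET].
have tr b m : has_clique c' b m -> clique_in c b m S.
  move=> /has_cliqueP[A Am /mono_cliqueP cA]; apply/existsP; exists (h @: A)%SET.
  apply/and3P; split.
  - by apply/fintype.subsetP => _ /imsetP[i _ ->]; apply: enum_valP.
  - by rewrite card_imset // Am.
  - apply/mono_cliqueP => _ _ /imsetP[x xA ->] /imsetP[y yA ->] xy.
    rewrite -(cA x y) //; last by apply: contraNneq xy => ->.
    by rewrite ffunE imsetU1 imset_set1.
by have /forallP/(_ c')/orP[/tr->|/tr->] := ramseyP k l; rewrite ?orbT.
Qed.

Lemma ramsey_lt_coloring k l m : (m < ramsey k l)%N ->
  exists c : coloring m,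
    ~~ clique_in c true k [set: 'I_m]%SET /\ ~~ clique_in c false l [set: 'I_m]%SET.
Proof.
move=> ltm; have /forallPn[c] : ~~ ramsey_prop k l m.
  by apply: contraTN ltm => /ramsey_min; rewrite -leqNgt.
by rewrite negb_or !has_cliqueE => /andP[]; exists c.
Qed.

(** * The excess and its descent *)

Section Excess.
Variables (R : realFieldType) (T : finType) (e : rel T) (q : R).
Implicit Types X Y : {set T}.

Definition excess X Y : R := \sum_(x in X) \sum_(y in Y) ((e x y)%:R - q).

Lemma excess_le X Y : 0 <= q -> excess X Y <= #|X|%:R * #|Y|%:R.
Proof.
move=> q0; rewrite -natrM -sum_nat_const natr_sum; apply: ler_sum => x _.
rewrite -sum1_card natr_sum; apply: ler_sum => y _.
by case: (e x y); rewrite ?mulr1n ?mulr0n; lra.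
Qed.

(** With [D y] the degree of [y] into [X] and [E y = D y - q * #|X|], the sum of
the right sides over [v] is [\sum_y D y * E y], and
[D y * E y - q * #|X| * E y = (E y) ^+ 2].  Hence the sum is at least
[q * #|X| * \sum_y E y = #|X| * (q * excess X Y)], and an average suffices.
The sets [X] and [Y] may overlap, which allows the descent to start from
[X = Y]. *)
Lemma exists_excess_nbhd X Y : symmetric e -> X != finset.set0 ->
  exists2 v, v \in X & q * excess X Y <= excess X (finset (fun y => (y \in Y) && e v y)).
Proof.
move=> esym /finset.set0Pn[x0 x0X].
pose D y : R := \sum_(x in X) (e x y)%:R.
pose E y : R := \sum_(x in X) ((e x y)%:R - q).
have DE y : E y = D y - q * #|X|%:R.
  by rewrite /E sumrB sumr_const mulr_natr.
have fE : excess X Y = \sum_(y in Y) E y by rewrite /excess exchange_big.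
have fN : \sum_(v in X) excess X (finset (fun y => (y \in Y) && e v y))
          = \sum_(y in Y) D y * E y.
  under eq_bigr => v _.
    rewrite /excess exchange_big /=.
    under eq_bigl => y do rewrite inE.
    rewrite big_mkcondr /=.
    over.
  rewrite exchange_big /=; apply: eq_bigr => y _.
  rewrite /D mulr_suml; apply: eq_bigr => v _.
  by case: (e v y); rewrite ?mul1r ?mul0r.
apply/exists_inP; apply: contraT => /exists_inPn H.
have : \sum_(v in X) excess X (finset (fun y => (y \in Y) && e v y))
      < \sum_(v in X) q * excess X Y.
  apply: ltr_sum => [|v vX]; last by rewrite ltNge H.
  by apply/hasP; exists x0; rewrite ?mem_index_enum.
rewrite fN sumr_const -[X in _ < X]mulr_natr fE mulrAC mulr_sumr ltNge.
case/negP; apply: ler_sum => y _.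
by rewrite -subr_ge0 -mulrBl -DE -expr2 sqr_ge0.
Qed.

End Excess.

Section Descent.
Variables (R : realFieldType) (n : nat) (c : coloring n).
Implicit Types (X Y : {set 'I_n}).

Definition red : rel 'I_n := fun x y => (y != x) && c [set x; y]%SET.

Lemma red_sym : symmetric red.
Proof. by move=> x y; rewrite /red eq_sym finset.setUC. Qed.

Lemma nbhd_red v Y : finset (fun y => (y \in Y) && red v y) = nbhd c true v Y.
Proof. by apply/finset.setP => y; rewrite !inE eqb_id. Qed.

Lemma excess_split (q : R) v X Y : v \in X ->
  excess red q X Y = excess red q [set v]%SET Y +
    (excess red q (nbhd c true v X) Y + excess red q (nbhd c false v X) Y).
Proof.
move=> vX; rewrite /excess (big_setD1 v) //= big_set1; congr (_ + _).
rewrite (bigID (fun x => c [set v; x]%SET)) /=.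
by congr (_ + _); apply: eq_bigl => x; rewrite !inE; case: (c _);
  rewrite ?andbT ?andbF // andbC.
Qed.

(** One step of the descent picks [v] from [exists_excess_nbhd] and passes to its
red or its blue neighbourhood in [X], whichever keeps its share [a] or [b] of
the excess; in both cases [Y] is replaced by the red neighbourhood of [v].
The hypothesis on [W] ends the descent if [Y] is large, and otherwise bounds
[#|Y|], hence what is lost by dropping [v] from [X]. *)
Lemma excess_clique (a b q W : R) k l X Y :
  0 < a -> a <= 1 -> 0 < b -> b <= 1 -> a + b < q -> 0 < W ->
  (forall i (S : {set 'I_n}), W <= a ^+ i * #|S|%:R -> clique_in c true i S) ->
  W <= (q - a - b) * (a ^+ k * b ^+ l) * excess red q X Y ->
  clique_in c true k (X :|: Y)%SET || clique_in c false l X.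
Proof.
move=> a0 a1 b0 b1 abq W0 hW.
have [m] := ubnP (k + l)%N; elim: m k l X Y => // m IHm k l X Y.
case: k => [|k]; first by rewrite clique_in0.
case: l => [|l]; first by rewrite clique_in0 orbT.
rewrite ltnS => klm hf.
have q0 : 0 < q by lra.
have [/hW cY|ltY] := leP W (a ^+ k.+1 * #|Y|%:R).
  by rewrite (clique_inS _ cY) // finset.subsetUr.
set f := excess red q X Y in hf.
have a'0 : 0 < a ^+ k.+1 by exact: exprn_gt0.
have b'0 : 0 < b ^+ l.+1 by exact: exprn_gt0.
have b'1 : b ^+ l.+1 <= 1 by rewrite exprn_ile1 // ltW.
have f0 : 0 < f.
  have := lt_le_trans W0 hf; rewrite pmulr_rgt0 // !mulr_gt0 // subr_gt0; lra.
(* Dropping [v] from [X] costs at most [#|Y|], which is within the gap between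
   [q * f] and [(a + b) * f]. *)
have Yf : #|Y|%:R <= (q - a - b) * f.
  rewrite -(ler_pM2l a'0); apply: (le_trans (ltW ltY)); apply: (le_trans hf).
  rewrite [leLHS](_ : _ = a ^+ k.+1 * ((q - a - b) * f) * b ^+ l.+1); last by ring.
  by rewrite ler_piMr // !mulr_ge0 ?(ltW a'0) ?(ltW f0) //; lra.
have X0 : X != finset.set0.
  by apply: contraTneq f0 => X0; rewrite /f X0 /excess big_set0 ltxx.
have [v vX] := exists_excess_nbhd q Y red_sym X0; rewrite nbhd_red -/f.
set Y' := nbhd _ _ _ _ => hv.
have Y'Y : (#|Y'|%:R : R) <= #|Y|%:R by rewrite ler_nat subset_leq_card ?nbhd_sub.
have hs := excess_split q Y' vX.
have hv1 := excess_le red [set v]%SET Y' (ltW q0).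
rewrite cards1 mul1r in hv1.
have abf : (a + b) * f <= excess red q (nbhd c true v X) Y' +
                          excess red q (nbhd c false v X) Y' by nra.
have [leR|ltR] := leP (a * f) (excess red q (nbhd c true v X) Y').
  have /orP[cR|cB] : clique_in c true k (nbhd c true v X :|: Y')%SET
                  || clique_in c false l.+1 (nbhd c true v X).
  - apply: IHm => //; apply: (le_trans hf); rewrite exprS.
    rewrite [leLHS](_ : _ = (q - a - b) * (a ^+ k * b ^+ l.+1) * (a * f)); last by ring.
    by rewrite ler_wpM2l // !mulr_ge0 ?exprn_ge0 ?ltW // subr_gt0; lra.
  - apply/orP; left; apply: (clique_inU1 (v := v)) cR; first by rewrite inE vX.
    by rewrite finset.subUset; apply/andP; split; apply/fintype.subsetP => x;
      rewrite !inE => /and3P[-> -> ->]; rewrite ?orbT.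
  - by rewrite (clique_inS (nbhd_sub _ _ _ _) cB) orbT.
have leB : b * f <= excess red q (nbhd c false v X) Y' by lra.
have /orP[cR|cB] : clique_in c true k.+1 (nbhd c false v X :|: Y')%SET
                || clique_in c false l (nbhd c false v X).
- apply: IHm; first by rewrite addSnnS.
  apply: (le_trans hf); rewrite (exprS b).
  rewrite [leLHS](_ : _ = (q - a - b) * (a ^+ k.+1 * b ^+ l) * (b * f)); last by ring.
  by rewrite ler_wpM2l // !mulr_ge0 ?exprn_ge0 ?ltW // subr_gt0; lra.
- by rewrite (clique_inS _ cR) // finset.setUSS ?nbhd_sub.
- by rewrite (clique_inU1 vX _ cB) ?orbT.
Qed.

End Descent.

(** * Binomial estimates *)

(** The terms of [(k + l) ^ (k + l)], expanded by Newton's formula, increase up to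
the index [l] and decrease after it: consecutive terms are in the ratio
[((k + l - m) * l) / ((m + 1) * k)]. *)
Lemma binomial_term_le_mode (k l i : nat) : (0 < k)%N -> (i <= k + l)%N ->
  ('C(k + l, i) * (k ^ (k + l - i) * l ^ i) <= 'C(k + l, l) * (k ^ k * l ^ l))%N.
Proof.
move=> k0.
pose t i := ('C(k + l, i) * (k ^ (k + l - i) * l ^ i))%N.
have -> : ('C(k + l, l) * (k ^ k * l ^ l) = t l)%N by rewrite /t addnK.
rewrite -/(t i) => iN.
have step m : (m < k + l)%N -> (t m.+1 * (m.+1 * k) = t m * ((k + l - m) * l))%N.
  move=> mN; rewrite /t -[in (k ^ (k + l - m))%N](subnSK mN) !expnS.
  have := mul_bin_left (k + l) m.
  move: (k ^ _)%N (l ^ _)%N ('C(_, m.+1)) ('C(_, m)) (_ - m)%N => A B c' c d E.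
  transitivity (m.+1 * c' * (k * A * (l * B)))%N; last rewrite E; ring.
have [li|/ltnW il] := leqP l i.
  elim: i li iN => [|i IHi]; first by rewrite leqn0 => /eqP->.
  rewrite leq_eqVlt ltnS => /orP[/eqP->//|li] iN.
  apply: leq_trans (IHi li (ltnW iN)).
  have := step _ iN; rewrite -(leq_pmul2r (_ : 0 < i.+1 * k)%N) ?muln_gt0 // => ->.
  by rewrite leq_mul2l; apply/orP; right; nia.
have [d Ed] : exists d, l = (i + d)%N by exists (l - i)%N; rewrite subnKC.
elim: d i {il iN} Ed => [|d IHd] i Ed; first by rewrite Ed addn0.
apply: leq_trans (IHd i.+1 _); last by rewrite Ed addnS.
have iN : (i < k + l)%N by lia.
have := step _ iN; rewrite -(leq_pmul2r (_ : 0 < (k + l - i) * l)%N) => [<-|].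
  by rewrite leq_mul2l; apply/orP; right; nia.
by rewrite muln_gt0; lia.
Qed.

Lemma bin_lower_bound (k l : nat) : (0 < k)%N ->
  ((k + l) ^ (k + l) <= (k + l).+1 * ('C(k + l, l) * (k ^ k * l ^ l)))%N.
Proof.
move=> k0; rewrite expnDn -[X in (X * _)%N]card_ord -sum_nat_const.
by apply: leq_sum => i _; apply: binomial_term_le_mode => //; rewrite -ltnS.
Qed.

Lemma bin_mul_index (k j : nat) : (0 < j)%N ->
  ('C(k + j, j) * j = 'C(k + j.-1, j.-1) * (k + j))%N.
Proof.
by case: j => // j _; rewrite addnS /= mulnC -mul_bin_diag mulnC.
Qed.

Section BinomialWeights.
Variable R : realFieldType.

(** One term of the expansion of [(a + (1 - a)) ^+ (k + l)]. *)
Lemma bin_mul_expr_le1 (a : R) k l : 0 <= a -> a <= 1 ->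
  'C(k + l, l)%:R * (a ^+ k * (1 - a) ^+ l) <= 1.
Proof.
move=> a0 a1.
have e1 : 1 = (a + (1 - a)) ^+ (k + l) by rewrite addrCA subrr addr0 expr1n.
rewrite [leRHS]e1.
have a1' : 0 <= 1 - a by lra.
have lN : (l < (k + l).+1)%N by rewrite ltnS leq_addl.
rewrite [leRHS]exprDn (bigD1 (Ordinal lN)) //= addnK mulr_natl lerDl.
by apply: sumr_ge0 => i _; rewrite mulrn_wge0 // mulr_ge0 // exprn_ge0.
Qed.

(** The mode of a binomial distribution on [k + j + 1] values has probability at
least [1 / (k + j + 1)]. *)
Lemma binomial_mass (k j : nat) (g : R) : (0 < k)%N -> g = j%:R / (k + j)%:R ->
  1 <= (k + j).+1%:R * ('C(k + j, j)%:R * ((1 - g) ^+ k * g ^+ j)).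
Proof.
move=> k0 Eg; have := bin_lower_bound j k0; rewrite -(ler_nat R).
have kj0 : (0 : R) < (k + j)%:R by rewrite ltr0n addn_gt0 k0.
have -> : 1 - g = k%:R / (k + j)%:R.
  by rewrite Eg natrD; field; rewrite -natrD gt_eqF.
rewrite Eg !exprMn !exprVn !natrM !natrX => h.
rewrite [leRHS](_ : _ = (k + j).+1%:R * ('C(k + j, j)%:R * (k%:R ^+ k * j%:R ^+ j)) / (k + j)%:R ^+ (k + j)).
  by rewrite ler_pdivlMr ?exprn_gt0 // mul1r.
by rewrite exprD; field; rewrite !expf_neq0 // gt_eqF.
Qed.

End BinomialWeights.

(** * Colourings with neither clique *)

Section NoClique.
Variable R : realFieldType.

(** The descent from [X = Y = V], with [W = (1 - a) ^- l]: by Erdos-Szekeres and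
[bin_mul_expr_le1], a set [S] with [1 <= a ^+ i * (1 - a) ^+ l * #|S|] contains
a red clique of size [i]. *)
Lemma excess_lt_of_no_clique n (c : coloring n) (a b q : R) k l :
  0 < a -> a < 1 -> 0 < b -> b <= 1 -> a + b < q ->
  ~~ clique_in c true k [set: 'I_n]%SET -> ~~ clique_in c false l [set: 'I_n]%SET ->
  (q - a - b) * (a ^+ k * (b * (1 - a)) ^+ l) *
    excess (red c) q [set: 'I_n]%SET [set: 'I_n]%SET < 1.
Proof.
move=> a0 a1 b0 b1 abq nR nB; rewrite ltNge; apply/negP => h.
have a1' : 0 < 1 - a by lra.
have W0 : 0 < (1 - a) ^+ l by exact: exprn_gt0.
have := @excess_clique R n c a b q ((1 - a) ^- l) k l [set: 'I_n]%SET [set: 'I_n]%SET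
  a0 (ltW a1) b0 b1 abq; rewrite finset.setUT (negPf nR) (negPf nB) invr_gt0 W0.
move=> /(_ isT) H; suff : false || false by []; apply: H => [i S hS|].
  have hC : ('C(i + l, l) <= #|S|)%N.
    rewrite -(ler_nat R).
    have hb := bin_mul_expr_le1 i l (ltW a0) (ltW a1).
    have A0 : 0 < a ^+ i * (1 - a) ^+ l by rewrite mulr_gt0 // exprn_gt0.
    rewrite -(ler_pM2r A0); apply: (le_trans hb).
    by move: hS; rewrite -(ler_pM2r W0) mulVf ?gt_eqF // mulrA [_ * a ^+ i]mulrC.
  have /orP[//|cB] := erdos_szekeres c hC.
  by case/negP: nB; apply: clique_inS cB; apply: finset.subsetT.
rewrite -(ler_pM2r W0) mulVf ?gt_eqF //; apply: (le_trans h).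
by rewrite exprMn le_eqVlt; apply/orP; left; apply/eqP; ring.
Qed.

(** A vertex has fewer than [ramsey k l.-1] blue neighbours, because a blue clique
of size [l.-1] among them would extend to one of size [l]. *)
Lemma excess_setT_ge n (c : coloring n) (q : R) k l : (0 < l)%N ->
  ~~ clique_in c true k [set: 'I_n]%SET -> ~~ clique_in c false l [set: 'I_n]%SET ->
  n%:R * (n%:R - (ramsey k l.-1)%:R - q * n%:R)
    <= excess (red c) q [set: 'I_n]%SET [set: 'I_n]%SET.
Proof.
move=> l0 nR nB.
have -> : n%:R * (n%:R - (ramsey k l.-1)%:R - q * n%:R)
   = \sum_(v in [set: 'I_n]%SET) (n%:R - (ramsey k l.-1)%:R - q * n%:R) :> R.
  by rewrite sumr_const cardsT card_ord mulr_natl.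
apply: ler_sum => v _; rewrite sumrB sumr_const cardsT card_ord mulr_natr lerB //.
rewrite -natr_sum.
have -> : (\sum_(y in [set: 'I_n]%SET) red c v y = #|nbhd c true v [set: 'I_n]%SET|)%N.
  by rewrite -nbhd_red -sum1_card big_mkcond /= [in RHS]big_mkcond; apply: eq_bigr => y _;
    rewrite !inE; case: (red c v y).
have := card_nbhd c (finset.in_setT v); rewrite cardsT card_ord => cN.
have : (#|nbhd c false v [set: 'I_n]%SET| < ramsey k l.-1)%N.
  rewrite ltnNge; apply/negP => /(ramsey_sub c) /orP[cR|cB].
    by case/negP: nR; apply: clique_inS cR; apply: finset.subsetT.
  case/negP: nB; rewrite -(prednK l0).
  exact: (clique_inU1 (finset.in_setT v) (subxx _) cB).
rewrite lerBlDr -natrD ler_nat => hB; lia.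
Qed.

(** The instance [a = 1 - 2 * g], [b = 8 / 10 * g], [q = 1 - 11 / 10 * g] of
[excess_lt_of_no_clique].  Here [a + b = 1 - 12 / 10 * g], and the hypothesis
makes the red density at least about [1 - 21 / 20 * g], so that [q] is
separated from both by a constant multiple of [g]. *)
Lemma ramsey_sq_bound (k j n : nat) (g : R) : (0 < j)%N -> (4 * j <= k)%N ->
  g = j%:R / (k + j)%:R -> ramsey k j = n.+1 ->
  (ramsey k j.-1)%:R <= 21%:R / 20%:R * g * (ramsey k j)%:R ->
  g ^+ 2 * (1 - 2%:R * g) ^+ k * (8%:R / 5%:R * g ^+ 2) ^+ j * (n%:R * (n%:R - 21%:R)) < 200%:R.
Proof.
move=> j0 jk Eg En hr.
have j0R : (0 : R) < j%:R by rewrite ltr0n.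
have jkR : (4%:R * j%:R : R) <= k%:R by rewrite -natrM ler_nat.
have kj0 : (0 : R) < (k + j)%:R by rewrite natrD; lra.
have g0 : 0 < g by rewrite Eg divr_gt0.
have g5 : g <= 1 / 5%:R by rewrite Eg ler_pdivrMr // natrD; lra.
have [c [nR nB]] : exists c : coloring n, ~~ clique_in c true k [set: 'I_n]%SET
    /\ ~~ clique_in c false j [set: 'I_n]%SET by apply: ramsey_lt_coloring; rewrite En.
pose q : R := 1 - 11%:R / 10%:R * g.
have h1 := excess_setT_ge q j0 nR nB.
have := @excess_lt_of_no_clique n c (1 - 2%:R * g) (8%:R / 10%:R * g) q k j.
have -> : q - (1 - 2%:R * g) - 8%:R / 10%:R * g = g / 10%:R by rewrite /q; field.
have -> : 8%:R / 10%:R * g * (1 - (1 - 2%:R * g)) = 8%:R / 5%:R * g ^+ 2 by field.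
move=> h2; have {h2} := h2 _ _ _ _ _ nR nB.
move=> /(_ ltac:(lra) ltac:(lra) ltac:(lra) ltac:(lra) ltac:(rewrite /q; lra)).
set Z := (1 - 2%:R * g) ^+ k; set W := (_ ^+ j); set E := excess _ _ _ _ in h1 *.
have Z0 : 0 <= Z by rewrite exprn_ge0 //; lra.
have W0 : 0 <= W by rewrite exprn_ge0 // mulr_ge0 ?sqr_ge0 //; lra.
move=> h2.
have h3 : g / 20%:R * (n%:R * (n%:R - 21%:R)) <= E.
  apply: le_trans h1; rewrite mulrCA ler_wpM2l ?ler0n //.
  by move: hr; rewrite En -natr1 /q => hr; lra.
have h4 : g / 10%:R * (Z * W) * (g / 20%:R * (n%:R * (n%:R - 21%:R))) <= g / 10%:R * (Z * W) * E.
  by rewrite ler_wpM2l // !mulr_ge0 // ltW.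
have := le_lt_trans h4 h2.
rewrite [ltLHS](_ : _ = g ^+ 2 * Z * W * (n%:R * (n%:R - 21%:R)) / 200%:R); last by field.
by rewrite ltr_pdivrMr ?mul1r // ltr0n.
Qed.

End NoClique.

(** * The critical index *)

Section CriticalIndex.

(** Going down from [l] while [rho] grows by a factor of more than [theta] cannot
last until [0], where [rho] vanishes; the index where it stops is the answer. *)
Lemma small_ratio_index (R : realFieldType) (rho : nat -> R) (theta : R) l :
  rho 0%N = 0 -> 0 <= theta -> 0 < rho l -> exists2 j, (0 < j <= l)%N &
    rho j.-1 <= theta * rho j /\ theta ^+ (l - j) * rho l <= rho j.
Proof.
move=> rho0 th0; elim: l => [|l IHl]; first by rewrite rho0 ltxx.
move=> rl; have [le|lt] := leP (rho l) (theta * rho l.+1).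
  by exists l.+1; rewrite ?leqnn // subnn expr0 mul1r.
have [|j /andP[j0 jl] [r1 r2]] := IHl; first by apply: le_lt_trans lt; rewrite mulr_ge0 // ltW.
exists j; first by rewrite j0 leqW.
split=> //; apply: le_trans r2.
by rewrite subSn // exprSr -mulrA ler_wpM2l ?exprn_ge0 // ltW.
Qed.

(** Since [(21 / 20) ^+ 2 * (39 / 40) ^+ 3 > 1], the growth over [l - j] steps pays
for [3 / 2 * (l - j)] factors [39 / 40]. *)
Lemma exponent_tradeoff (R : realFieldType) (l j : nat) : (j <= l)%N ->
  (21%:R / 20%:R : R) ^+ (l - j) * (39%:R / 40%:R) ^+ l <= 1 -> (l <= 3 * j)%N.
Proof.
move=> jl; apply: contraTT; rewrite -ltNge -ltnNge => hj.
have [d0 d3] : (l - j != 0)%N /\ (l * 2 <= 3 * (l - j))%N by lia.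
move: {hj jl} (l - j)%N d0 d3 => d d0 d3.
have th0 : (0 : R) <= 21%:R / 20%:R by lra.
have [t0 t1] : (0 : R) <= 39%:R / 40%:R /\ (39%:R / 40%:R : R) <= 1 by lra.
have h : 1 < (21%:R / 20%:R : R) ^+ 2 * (39%:R / 40%:R) ^+ 3 by lra.
move: (21%:R / 20%:R) (39%:R / 40%:R) th0 t0 t1 h => theta t th0 t0 t1 h.
rewrite -(@ltr_pXn2r _ 2) ?nnegrE ?mulr_ge0 ?exprn_ge0 //.
rewrite expr1n exprMn exprAC -[(t ^+ l) ^+ 2]exprM.
apply: (@lt_le_trans _ _ ((theta ^+ 2) ^+ d * t ^+ (3 * d))).
  by rewrite exprM -exprMn exprn_egt1.
by rewrite ler_wpM2l ?exprn_ge0 // ler_wiXn2l.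
Qed.

Variable R : realType.

(** With [x = j / k] one has [1 - 2 * g = (1 - g) ^+ 2 * (1 - x ^+ 2)], and
[(1 - x ^+ 2) ^+ k] is at least about [expR (- (x ^+ 2 * k)) = expR (- (x * j))],
where [x <= 1 / 4]. *)
Lemma expr_1B2_ge (k j : nat) (g : R) : (0 < j)%N -> (4 * j <= k)%N ->
  g = j%:R / (k + j)%:R ->
  (11%:R / 15%:R) ^+ j * ((1 - g) ^+ k) ^+ 2 <= (1 - 2%:R * g) ^+ k.
Proof.
move=> j0 jk Eg.
have j0R : (0 : R) < j%:R by rewrite ltr0n.
have jkR : (4%:R * j%:R : R) <= k%:R by rewrite -natrM ler_nat.
have k0R : (0 : R) < k%:R by lra.
pose x : R := j%:R / k%:R.
have x0 : 0 < x by rewrite divr_gt0.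
have x4 : x <= 1 / 4%:R by rewrite ler_pdivrMr //; lra.
have -> : 1 - 2%:R * g = (1 - g) ^+ 2 * (1 - x ^+ 2).
  rewrite Eg /x natrD; field; apply/andP; split; apply/eqP; lra.
suff xk : (11%:R / 15%:R) ^+ j <= (1 - x ^+ 2) ^+ k.
  rewrite [leRHS]exprMn exprAC [leLHS]mulrC ler_wpM2l //.
  by apply: exprn_ge0; exact: sqr_ge0.
(* [16 / 15 = 1 / (1 - 1 / 16)], and [x ^+ 2 <= 1 / 16]. *)
pose z : R := 16%:R / 15%:R * x ^+ 2.
have zx : expR (- z) <= 1 - x ^+ 2.
  rewrite expRN -[leRHS]invrK lef_pV2 ?posrE ?invr_gt0 ?expR_gt0 //; last by nra.
  apply: le_trans (expR_ge1Dx z); rewrite -[leLHS]mul1r ler_pdivrMr; last by nra.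
  rewrite /z; have : x ^+ 2 <= 1 / 16%:R by nra.
  by have := sqr_ge0 x; move: (x ^+ 2) => y *; nra.
apply: (@le_trans _ _ (expR (- z) ^+ k)); last first.
  by rewrite lerXn2r // ?nnegrE ?expR_ge0 //; apply: le_trans zx; exact: expR_ge0.
have -> : expR (- z) ^+ k = expR (- (16%:R / 15%:R * x)) ^+ j.
  rewrite -!expRM_natl; congr expR; rewrite /z /x; field; apply/eqP; lra.
rewrite lerXn2r // ?nnegrE ?expR_ge0 ?divr_ge0 ?ler0n //.
by apply: le_trans (expR_ge1Dx _); lra.
Qed.

(** The upper bound on [ramsey k j] from [ramsey_sq_bound] meets the lower bound
from [binomial_mass]; what remains of the exponential factors is
[((39 / 40) ^+ 2 * (8 / 5) * (11 / 15)) ^+ j], and the base exceeds [11 / 10]. *)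
Lemma critical_index_bound (k j : nat) : (0 < j)%N -> (4 * j <= k)%N ->
  (39%:R / 40%:R : R) ^+ j * 'C(k + j, j)%:R <= (ramsey k j)%:R ->
  (ramsey k j.-1)%:R <= 21%:R / 20%:R * (j%:R / (k + j)%:R) * (ramsey k j)%:R :> R ->
  (11%:R / 10%:R : R) ^+ j <= 1000%:R * (k + j).+1%:R ^+ 4.
Proof.
move=> j0 jk h1 hr; set g : R := j%:R / (k + j)%:R in hr.
have k0 : (0 < k)%N by apply: leq_trans jk; rewrite muln_gt0.
have j0R : (0 : R) < j%:R by rewrite ltr0n.
have jkR : (4%:R * j%:R : R) <= k%:R by rewrite -natrM ler_nat.
have kj0 : (0 : R) < (k + j)%:R by rewrite natrD; lra.
have g0 : 0 < g by rewrite divr_gt0.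
have g5 : g <= 1 / 5%:R by rewrite ler_pdivrMr // natrD; lra.
have pos (x : R) m : 0 <= x -> 0 <= x ^+ m by move=> ?; rewrite exprn_ge0.
have c0 : (0 : R) < 'C(k + j, j)%:R by rewrite ltr0n bin_gt0 leq_addl.
have s0 : (0 < ramsey k j)%N.
  rewrite -(ltr_nat R); apply: lt_le_trans h1; rewrite mulr_gt0 // exprn_gt0 //; lra.
have h3 := expr_1B2_ge j0 jk (erefl g).
have h4 := binomial_mass k0 (erefl g).
set N1 : R := (k + j).+1%:R in h4 *.
have N1ge1 : 1 <= N1 by rewrite ler1n.
have gN : 1 <= g * N1.
  have j1 : (1 : R) <= j%:R by rewrite ler1n.
  rewrite /g mulrAC ler_pdivlMr // mul1r; apply: (@le_trans _ _ N1); last by rewrite ler_peMl.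
  by rewrite /N1 ler_nat leqnSn.
have N4 : N1 <= N1 ^+ 4 by rewrite ler_eXnr.
set P := (1 - g) ^+ k * g ^+ j in h4.
have P0 : 0 <= P by rewrite mulr_ge0 // pos; lra.
have PN0 : 0 <= P * N1 by apply: mulr_ge0 => //; lra.
have h5 : (39%:R / 40%:R : R) ^+ j <= (ramsey k j)%:R * P * N1.
  rewrite -mulrA; apply: le_trans (ler_wpM2r PN0 h1).
  rewrite -[leLHS]mulr1 -mulrA ler_wpM2l //.
  by rewrite mulrA mulrC.
have [n En] : exists n, ramsey k j = n.+1 by exists (ramsey k j).-1; rewrite prednK.
have h2 := ramsey_sq_bound j0 jk (erefl g) En hr.
have sE : (ramsey k j)%:R = n%:R + 1 :> R by rewrite En natr1.
rewrite sE in h5.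
(* From 105 vertices on, [n * (n - 21)] is at least [7 / 10 * (n + 1) ^+ 2]; for
   fewer vertices [h5] alone bounds [(39 / 8) ^+ j] by [105 * N1]. *)
have [n105|n105] := leqP 105 n.
  have {n105}n105 : (105%:R : R) <= n%:R by rewrite ler_nat.
  set s : R := n%:R + 1 in h5.
  pose Q := (1 - 2%:R * g) ^+ k * (8%:R / 5%:R * g ^+ 2) ^+ j.
  have Q0 : 0 <= Q by rewrite mulr_ge0 // pos ?mulr_ge0 ?sqr_ge0 //; lra.
  have h6 : g ^+ 2 * Q * s ^+ 2 < 300%:R.
    have : 7%:R / 10%:R * s ^+ 2 <= n%:R * (n%:R - 21%:R) by rewrite /s; nra.
    move=> hs; have := ler_wpM2l (_ : 0 <= g ^+ 2 * Q) hs.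
    rewrite mulr_ge0 ?sqr_ge0 // => /(_ isT) h6.
    have h2' : g ^+ 2 * Q * (n%:R * (n%:R - 21%:R)) < 200%:R by rewrite [g ^+ 2 * Q]mulrA.
    by have := le_lt_trans h6 h2'; rewrite mulrCA; lra.
  have h7 : (11%:R / 10%:R : R) ^+ j <= s ^+ 2 * N1 ^+ 2 * Q.
    have h8 : (11%:R / 10%:R : R) ^+ j <=
        ((39%:R / 40%:R) ^+ j) ^+ 2 * (8%:R / 5%:R) ^+ j * (11%:R / 15%:R) ^+ j.
      by rewrite exprAC -!exprMn lerXn2r // ?nnegrE; lra.
    apply: (le_trans h8); rewrite /Q [X in _ <= _ * (_ * X)]exprMn [(g ^+ 2) ^+ j]exprAC.
    have e8 : 0 <= (8%:R / 5%:R : R) ^+ j by apply: pos; lra.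
    have e11 : 0 <= (11%:R / 15%:R : R) ^+ j by apply: pos; lra.
    have T0 : 0 <= (39%:R / 40%:R : R) ^+ j by apply: pos; lra.
    have h9 : ((39%:R / 40%:R : R) ^+ j) ^+ 2 <= (s * P * N1) ^+ 2.
      by rewrite lerXn2r // nnegrE (le_trans T0 h5).
    apply: le_trans (ler_wpM2r e11 (ler_wpM2r e8 h9)) _; rewrite /P.
    have G0 : 0 <= s ^+ 2 * N1 ^+ 2 * ((8%:R / 5%:R) ^+ j * (g ^+ j) ^+ 2).
      by apply: mulr_ge0; apply: mulr_ge0 => //; exact: sqr_ge0.
    have := ler_wpM2l G0 h3; set a := (1 - g) ^+ k; set e := (11%:R / 15%:R) ^+ j.
    set f := (8%:R / 5%:R) ^+ j; set u := g ^+ j; set z := (1 - _) ^+ k.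
    by congr (_ <= _); ring.
  have h10 : s ^+ 2 * N1 ^+ 2 * Q <= N1 ^+ 4 * (g ^+ 2 * Q * s ^+ 2).
    have := ler_wpM2r (_ : 0 <= s ^+ 2 * N1 ^+ 2 * Q) (_ : 1 <= (g * N1) ^+ 2).
    rewrite mul1r [X in _ -> _ -> _ <= X](_ : _ = N1 ^+ 4 * (g ^+ 2 * Q * s ^+ 2)); last by ring.
    apply; last by rewrite expr_ge1 //; lra.
    by apply: mulr_ge0 => //; apply: mulr_ge0; exact: sqr_ge0.
  apply: (le_trans h7); apply: (le_trans h10).
  by rewrite mulrC ler_wpM2r ?pos //; lra.
have h6 : (39%:R / 40%:R : R) ^+ j <= 105%:R * (1 / 5%:R) ^+ j * N1.
  apply: (le_trans h5); rewrite ler_wpM2r //.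
  have hn : n%:R + 1 <= 105%:R :> R by rewrite natr1 ler_nat.
  apply: ler_pM => //.
  rewrite /P -[leRHS]mul1r; apply: ler_pM; [by apply: pos; lra|by apply: pos; lra| |].
    by rewrite exprn_ile1 //; lra.
  by rewrite lerXn2r ?nnegrE //; lra.
have h7 : (39%:R / 8%:R : R) ^+ j <= 105%:R * N1.
  have E : (39%:R / 40%:R : R) = 39%:R / 8%:R * (1 / 5%:R) by field.
  by rewrite E exprMn mulrAC ler_pM2r // in h6.
apply: (@le_trans _ _ ((39%:R / 8%:R) ^+ j)); first by rewrite lerXn2r ?nnegrE //; lra.
by apply: (le_trans h7); lra.
Qed.

End CriticalIndex.

(** * Exponential against polynomial growth *)

Section Growth.
Variable R : archiRealFieldType.

Lemma bernoulli (x : R) m : 0 <= x -> 1 + m%:R * x <= (1 + x) ^+ m.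
Proof.
move=> x0; elim: m => [|m IHm]; first by rewrite mul0r addr0 expr0.
rewrite exprS -natr1.
have mx : (0 : R) <= m%:R by rewrite ler0n.
have := ler_wpM2l (_ : 0 <= 1 + x) IHm; rewrite addr_ge0 // => /(_ isT).
by apply: le_trans; nra.
Qed.

(** Bernoulli's inequality for the exponent [j %/ 5], raised to the fifth power. *)
Lemma quintic_le_expr (j : nat) : (j%:R / 50%:R) ^+ 5 <= (11%:R / 10%:R : R) ^+ j.
Proof.
have Ej := divn_eq j 5; set m := (j %/ 5)%N in Ej.
have jm : (j <= 5 * m + 5)%N by have := ltn_pmod j (isT : 0 < 5)%N; lia.
have mj : (m * 5 <= j)%N by lia.
have e11 : (11%:R / 10%:R : R) = 1 + 10%:R^-1 by field.
apply: (@le_trans _ _ ((11%:R / 10%:R) ^+ (m * 5))); last first.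
  by rewrite ler_weXn2l // e11; lra.
rewrite exprM lerXn2r ?nnegrE ?divr_ge0 ?exprn_ge0 ?ler0n //.
rewrite e11; apply: le_trans (bernoulli m _); last by rewrite invr_ge0 ler0n.
have : (j%:R : R) <= 5%:R * m%:R + 5%:R by rewrite -natrM -natrD ler_nat.
have : (0 : R) <= m%:R by rewrite ler0n.
by lra.
Qed.

Lemma quartic_lt_expr (K : R) : 0 <= K -> exists N : nat,
  forall j, (N <= j)%N -> 1000%:R * (K * j%:R) ^+ 4 < (11%:R / 10%:R : R) ^+ j.
Proof.
move=> K0.
pose B := 1000%:R * K ^+ 4 * 50%:R ^+ 5.
exists (Num.bound B).+1 => j Nj; apply: lt_le_trans (quintic_le_expr j).
have Bj : B < j%:R.
  apply: lt_le_trans (archi_boundP _) _; first by rewrite !mulr_ge0 ?exprn_ge0 ?ler0n.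
  by rewrite ler_nat ltnW.
have j0 : (0 : R) < j%:R by rewrite ltr0n; apply: leq_trans Nj.
rewrite [ltRHS]exprMn exprVn ltr_pdivlMr ?exprn_gt0 ?ltr0n //.
rewrite [ltLHS](_ : _ = B * j%:R ^+ 4); last by rewrite /B; ring.
by rewrite [ltRHS]exprS ltr_pM2r // exprn_gt0.
Qed.

End Growth.

(** * The upper bound *)

Theorem theorem10p1 (R : realType) (gamma0 : R) (gamma0_gt0 : 0 < gamma0) :
  exists N : nat, forall k l : nat, (N <= k)%N -> (N <= l)%N ->
    let gamma : R := l%:R / (k + l)%N%:R in
    let delta : R := gamma / 40%:R in
    gamma0 <= gamma -> gamma <= 1 / 5%:R ->
    (ramsey k l)%:R <= expR (- (delta * k%:R) + 1) * 'C(k + l, l)%N%:R.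
Proof.
(* [k + l <= l / gamma0] and [l <= 3 * j] will give [k + j + 1 <= K * j]. *)
pose K : R := 3%:R / gamma0 + 1.
have K0 : 0 <= K by rewrite addr_ge0 // divr_ge0 // ltW.
have [N0 HN0] := quartic_lt_expr K0.
exists (3 * N0).+1 => k l kN lN gamma delta g0 g5.
have l0 : (0 < l)%N by apply: leq_trans lN.
have k0 : (0 < k)%N by apply: leq_trans kN.
have kl0 : (0 : R) < (k + l)%:R by rewrite ltr0n addn_gt0 k0.
have lk : (4 * l <= k)%N.
  by move: g5; rewrite /gamma ler_pdivrMr // -(ler_nat R) natrM natrD; lra.
have klK : (k + l)%:R <= l%:R / gamma0 by rewrite ler_pdivlMr // mulrC -ler_pdivlMr.
rewrite leNgt; apply/negP => hlt.
pose C i : R := 'C(k + i, i)%:R.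
have C0 i : 0 < C i by rewrite ltr0n bin_gt0 leq_addl.
pose rho i : R := (ramsey k i)%:R / C i.
have rho1 i : rho i <= 1 by rewrite ler_pdivrMr // mul1r ler_nat ramsey_le_bin.
pose t : R := 39%:R / 40%:R.
have t0 : 0 < t by rewrite /t; lra.
(* Since [delta * k <= l / 40] and [39 / 40 <= expR (- (1 / 40))]; the summand [1]
   in the exponent is given away. *)
have rhol : t ^+ l <= rho l.
  rewrite ler_pdivlMr //; apply/ltW/(le_lt_trans _ hlt).
  apply: ler_wpM2r; first exact: (ltW (C0 l)).
  apply: (@le_trans _ _ (expR (- (1 / 40%:R)) ^+ l)).
    have te : t <= expR (- (1 / 40%:R)).
      by apply: le_trans (expR_ge1Dx _); rewrite /t; lra.
    by rewrite lerXn2r // nnegrE ?expR_ge0 // ltW.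
  rewrite -expRM_natl ler_expR.
  suff : delta * k%:R <= l%:R / 40%:R by lra.
  rewrite /delta mulrAC ler_pM2r ?invr_gt0 // /gamma mulrAC ler_pdivrMr //.
  by rewrite ler_pM2l ?ltr0n // ler_nat leq_addr.
pose theta : R := 21%:R / 20%:R.
have th0 : 0 <= theta by rewrite /theta; lra.
have [|||j /andP[j0 jl] [r1 r2]] := @small_ratio_index R rho theta l.
- by rewrite /rho ramseyn0 mul0r.
- exact: th0.
- by apply: lt_le_trans rhol; rewrite exprn_gt0.
have r3 : theta ^+ (l - j) * t ^+ l <= rho j.
  by apply: le_trans r2; rewrite ler_wpM2l ?exprn_ge0.
have l3j : (l <= 3 * j)%N by apply: (exponent_tradeoff jl); apply: le_trans r3 (rho1 j).
(* Each step down gains [theta], which outweighs the lost factor [t]. *)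
have hj1 : t ^+ j <= rho j.
  apply: le_trans r3; rewrite -{2}(subnK jl) exprD mulrA -exprMn.
  rewrite -[leLHS]mul1r ler_wpM2r ?exprn_ge0 ?(ltW t0) // exprn_ege1 //.
  by rewrite /theta /t; lra.
have h1 : t ^+ j * C j <= (ramsey k j)%:R by rewrite -ler_pdivlMr.
(* The binomial coefficients change by the factor [(k + j) / j]. *)
have h2 : (ramsey k j.-1)%:R <= theta * (j%:R / (k + j)%:R) * (ramsey k j)%:R.
  have Cj : C j * j%:R = C j.-1 * (k + j)%:R.
    rewrite /C -!natrM; congr _%:R.
    exact: bin_mul_index.
  have kj0 : (0 : R) < (k + j)%:R by rewrite ltr0n addn_gt0 k0.
  move: r1; rewrite /rho ler_pdivrMr // => /le_trans; apply.
  rewrite le_eqVlt; apply/orP; left; apply/eqP.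
  have -> : C j.-1 = C j * j%:R / (k + j)%:R by rewrite Cj mulfK // gt_eqF.
  move: (C0 j) kj0; move: (C j) ((k + j)%:R) => x y x0 y0.
  by field; rewrite !gt_eqF.
have jk : (4 * j <= k)%N by apply: leq_trans lk; rewrite leq_mul2l jl orbT.
have N0j : (N0 <= j)%N.
  by rewrite -(@leq_pmul2l 3) //; apply: leq_trans l3j; apply: ltnW.
have := critical_index_bound j0 jk h1 h2; apply/negP; rewrite -ltNge.
apply: le_lt_trans (HN0 j N0j).
have c0 : (0 : R) < 1000%:R by rewrite ltr0n.
rewrite (ler_pM2l c0); apply: lerXn2r; rewrite ?nnegrE ?ler0n //.
  by apply: mulr_ge0 => //; exact: ler0n.
have jR : (l%:R : R) <= 3%:R * j%:R by rewrite -natrM ler_nat.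
have j1 : (1 : R) <= j%:R by rewrite ler1n.
have kjl : ((k + j)%:R : R) <= (k + l)%:R by rewrite ler_nat leq_add2l.
have : l%:R / gamma0 <= 3%:R * j%:R / gamma0 by rewrite ler_pM2r ?invr_gt0.
have -> : K * j%:R = 3%:R * j%:R / gamma0 + j%:R by rewrite /K; ring.
by rewrite -[(k + j).+1%:R]natr1; lra.
Qed.
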